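(* Let $\alpha$ be a positive real number, let $F = \bigcup_{n=1}^\infty \mathbb{C}((x^{1/n}))$ be the field of Puiseux series, and let $\sigma$ be the $\mathbb{C}$-automorphism of $F$ determined by $\sigma(x^{1/n}) = \sqrt[n]{\alpha}\,x^{1/n}$ for all $n \geq 1$ (positive real $n$-th roots). Then the only $\sigma$-zero in $F$ of the polynomial $p = (t-1)^2 = t^2-2t+1 \in F[t,\sigma]$ is $1$. Consequently (taking $\alpha\neq 1$), there exist a field $K$, an automorphism $\sigma\neq\mathrm{id}$ of $K$ such that $K$ is algebraically closed with respect to $\sigma$, and a polynomial in $K[t,\sigma]$ of degree larger than $1$ with non-zero constant term that has only one $\sigma$-zero in $K$.
   Context: The symbols $x^{1/n}$ are chosen compatibly, $(x^{1/(nk)})^k = x^{1/n}$; explicitly $\sigma(\sum_j f_j x^{j/n}) = \sum_j f_j \alpha^{j/n} x^{j/n}$ with $\alpha^{j/n}$ the positive real power. For a field $K$ with endomorphism $\sigma$, the skew polynomial ring $K[t,\sigma]$ consists of polynomials $\sum_i f_i t^i$ with left coefficients in $K$, with multiplication determined by $ta = \sigma(a)t$ for $a\in K$. An element $a\in K$ is a $\sigma$-zero of $f=\sum_i f_i t^i\in K[t,\sigma]$ if $f$ is right-hand divisible by $t-a$ in $K[t,\sigma]$; equivalently, if $f_0 + f_1 a + f_2\sigma(a) a + f_3\sigma^2(a)\sigma(a)a+\cdots = 0$. The field $K$ is algebraically closed with respect to $\sigma$ if every non-constant polynomial in $K[t,\sigma]$ factors into a product of linear (degree $1$) polynomials. 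*)

(* Defs.v *)
From HB Require Import structures.
From mathcomp Require Import all_boot all_order all_algebra.
From mathcomp Require Import boolp classical_sets functions cardinality fsbigop.
From mathcomp Require Import reals exp interval_inference.
From mathcomp Require Import complex.

Set Implicit Arguments.
Unset Strict Implicit.
Unset Printing Implicit Defensive.

Import Order.TTheory GRing.Theory Num.Theory.

Local Open Scope ring_scope.

Section PowerSeries.
Context {K : fieldType}.
Implicit Types (u v w : nat -> K) (k N : nat).

Definition psmul u v : nat -> K := fun k => \sum_(i < k.+1) u i * v (k - i)%N.

Lemma psmul_trunc u v N k : (k < N)%N ->
  psmul u v k = (\poly_(i < N) u i * \poly_(i < N) v i)`_k.
Proof.
move=> kN; rewrite coefM; apply: eq_bigr => i _.
by rewrite !coef_poly (leq_ltn_trans _ kN) ?leq_ord// (leq_ltn_trans _ kN)// leq_subr.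
Qed.

Lemma psmulC u v : psmul u v = psmul v u.
Proof. by apply/funext => k; rewrite !(@psmul_trunc _ _ k.+1)// mulrC. Qed.

Lemma psmulA u v w : psmul u (psmul v w) = psmul (psmul u v) w.
Proof.
apply/funext => k; pose P (x : nat -> K) := \poly_(i < k.+1) x i.
transitivity ((P u * (P v * P w))`_k).
  rewrite coefM; apply: eq_bigr => i _; rewrite coef_poly ltn_ord.
  by rewrite (@psmul_trunc _ _ k.+1)// ltnS leq_subr.
rewrite mulrA coefM; apply: eq_bigr => i _.
rewrite coef_poly ltnS leq_subr.
by rewrite (@psmul_trunc _ _ k.+1).
Qed.

Lemma psmulDl u v w : psmul (u + v) w = psmul u w + psmul v w.
Proof.
apply/funext => k; rewrite [RHS]/GRing.add /= /psmul -big_split/=.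
by apply: eq_bigr => i _; rewrite mulrDl.
Qed.

Definition ps1 : nat -> K := fun k => (k == 0%N)%:R.

Lemma psmul1 u : psmul ps1 u = u.
Proof.
apply/funext => k; rewrite /psmul big_ord_recl /ps1 eqxx mul1r subn0.
by rewrite big1 ?addr0// => i _; rewrite lift0 mul0r.
Qed.

Fixpoint psinv_seq u k : seq K :=
  if k is k'.+1 then
    let s := psinv_seq u k' in
    rcons s ((u 0%N)^-1 * ((k' == 0%N)%:R - \sum_(i < k') u i.+1 * s`_(k' - i.+1)))
  else [::].

Definition psinv u : nat -> K := fun k => (psinv_seq u k.+1)`_k.

Lemma size_psinv_seq u k : size (psinv_seq u k) = k.
Proof. by elim: k => //= k IH; rewrite size_rcons IH. Qed.

Lemma nth_psinv_seq u k i : (i < k)%N -> (psinv_seq u k)`_i = psinv u i.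
Proof.
elim: k => // k IH; rewrite ltnS leq_eqVlt => /predU1P[->//|ik].
by rewrite /= nth_rcons size_psinv_seq ik IH.
Qed.

Lemma psmulV u : u 0%N != 0 -> psmul u (psinv u) = ps1.
Proof.
move=> u0; apply/funext => k; rewrite /psmul big_ord_recl subn0.
rewrite {1}/psinv /= nth_rcons size_psinv_seq ltnn eqxx mulVKf//.
rewrite (eq_bigr (fun i : 'I_k => u i.+1 * psinv u (k - i.+1)%N)); last first.
  move=> i _; rewrite nth_psinv_seq//.
  by rewrite -subSn ?ltn_ord// subSS leq_subr.
by rewrite subrK.
Qed.

End PowerSeries.

(* A Puiseux series [\sum_q f q x^q] is encoded by its coefficient function
   [f : rat -> K].  It belongs to K((x^(1/n))) if, for some m, its support
   consists of exponents j/n with m <= j. *)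

Section PuiseuxRaw.
Context {K : fieldType}.
Implicit Types (f g h : rat -> K) (u v w : nat -> K) (n k : nat) (m : int).

Definition laurent_in n m f : Prop :=
  forall q, f q != 0 -> exists2 j : int, m <= j & q = j%:~R / n%:R.

Definition is_puiseux f : Prop :=
  exists n m, (0 < n)%N /\ laurent_in n m f.

(* The sum has only finitely many nonzero terms when f and g are Puiseux
   series. *)
Definition puiseux_mul_fun f g : rat -> K :=
  fun q => \sum_(r \in [set: rat]) f r * g (q - r).

(* x^(m/n) * \sum_k u k x^(k/n) *)
Definition of_ps n m u : rat -> K := fun q =>
  let k := Num.truncn (q * n%:R - m%:~R) in
  if q == (m + k%:Z)%:~R / n%:R then u k else 0.

Lemma of_psE n m u k : (0 < n)%N -> of_ps n m u ((m + k%:Z)%:~R / n%:R) = u k.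
Proof.
move=> n0; have n0' : n%:R != 0 :> rat by rewrite pnatr_eq0 -lt0n.
by rewrite /of_ps divfK// intrD addrAC subrr add0r natrK -intrD eqxx.
Qed.

Lemma of_ps_neq0 n m u q : of_ps n m u q != 0 ->
  exists k, q = (m + k%:Z)%:~R / n%:R.
Proof.
rewrite /of_ps /=; case: ifP => [/eqP qE _|]; last by rewrite eqxx.
by exists (Num.truncn (q * n%:R - m%:~R)).
Qed.

Lemma laurent_inP n m f : (0 < n)%N -> laurent_in n m f ->
  f = of_ps n m (fun k => f ((m + k%:Z)%:~R / n%:R)).
Proof.
move=> n0 nf; apply/funext => q; rewrite /of_ps; case: eqP => [<-//|qN].
apply/eqP; apply: contra_notT qN => /nf[j mj qE].
have [k jE] : exists k : nat, j = m + k%:Z.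
  by exists `|j - m|%N; rewrite gez0_abs ?subr_ge0// addrCA subrr addr0.
have n0' : n%:R != 0 :> rat by rewrite pnatr_eq0 -lt0n.
suff -> : Num.truncn (q * n%:R - m%:~R) = k by rewrite -jE.
by rewrite qE jE divfK// intrD addrAC subrr add0r natrK.
Qed.

Lemma laurent_in_of_ps n m u : laurent_in n m (of_ps n m u).
Proof.
by move=> q /of_ps_neq0[k ->]; exists (m + k%:Z) => //; rewrite lerDl.
Qed.

Lemma is_puiseux_of_ps n m u : (0 < n)%N -> is_puiseux (of_ps n m u).
Proof. by move=> n0; exists n, m; split=> //; exact: laurent_in_of_ps. Qed.

Lemma laurent_in_le n m m' f : m' <= m -> laurent_in n m f -> laurent_in n m' f.
Proof.
by move=> mm' nf q /nf[j mj ->]; exists j => //; exact: le_trans mj.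
Qed.

Lemma laurent_in_mul n d m f : (0 < d)%N ->
  laurent_in n m f -> laurent_in (n * d) (m * d%:Z) f.
Proof.
move=> d0 nf q /nf[j mj ->]; exists (j * d%:Z); first by rewrite ler_wpM2r.
by rewrite intrM natrM -mulf_div divff ?mulr1// pnatr_eq0 -lt0n.
Qed.

Lemma puiseux_rep3 f g h : is_puiseux f -> is_puiseux g -> is_puiseux h ->
  exists n m u v w, [/\ (0 < n)%N,
    f = of_ps n m u, g = of_ps n m v & h = of_ps n m w].
Proof.
move=> [n1 [m1 [n10 f1]]] [n2 [m2 [n20 g2]]] [n3 [m3 [n30 h3]]].
have d1 : (0 < n2 * n3)%N by rewrite muln_gt0 n20.
have d2 : (0 < n1 * n3)%N by rewrite muln_gt0 n10.
have d3 : (0 < n1 * n2)%N by rewrite muln_gt0 n10.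
have := laurent_in_mul d1 f1; have := laurent_in_mul d2 g2.
have := laurent_in_mul d3 h3.
rewrite (_ : n2 * (n1 * n3) = n1 * (n2 * n3))%N; last by rewrite mulnCA.
rewrite (_ : n3 * (n1 * n2) = n1 * (n2 * n3))%N; last by rewrite mulnC mulnA.
set n := (n1 * _)%N; set a := m3 * _; set b := m2 * _; set c := m1 * _.
have n0 : (0 < n)%N by rewrite muln_gt0 n10.
pose m : int := Num.min a (Num.min b c).
move=> /(@laurent_in_le _ _ m) nh /(@laurent_in_le _ _ m) ng
  /(@laurent_in_le _ _ m) nf.
exists n, m; do 3 eexists; split => //.
- by apply: laurent_inP => //; apply: nf; rewrite /m !ge_min lexx ?orbT.
- by apply: laurent_inP => //; apply: ng; rewrite /m !ge_min lexx ?orbT.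
- by apply: laurent_inP => //; apply: nh; rewrite /m !ge_min lexx ?orbT.
Qed.

Lemma of_psD n m u v : of_ps n m (u + v) = of_ps n m u + of_ps n m v.
Proof.
apply/funext => q; rewrite [RHS]/GRing.add /= /of_ps.
by case: ifP => _; rewrite ?addr0.
Qed.

Lemma of_psN n m u : of_ps n m (- u) = - of_ps n m u.
Proof.
apply/funext => q; rewrite [RHS]/GRing.opp /= /of_ps.
by case: ifP => _; rewrite ?oppr0.
Qed.

Lemma of_psM n m m' u v : (0 < n)%N ->
  puiseux_mul_fun (of_ps n m u) (of_ps n m' v) = of_ps n (m + m') (psmul u v).
Proof.
move=> n0; have n0' : n%:R != 0 :> rat by rewrite pnatr_eq0 -lt0n.
apply/funext => q; rewrite /puiseux_mul_fun.
have [[k qE]|qN] := pselect (exists k : nat, q = (m + m' + k%:Z)%:~R / n%:R).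
  pose e (i : nat) : rat := (m + i%:Z)%:~R / n%:R.
  have einj : injective e.
    move=> i j /(congr1 ( *%R^~ n%:R)); rewrite !divfK//.
    by move=> /intr_inj/addrI[].
  have qe i : (i <= k)%N -> q - e i = (m' + (k - i)%N%:Z)%:~R / n%:R.
    move=> ik; rewrite qE -mulrBl -intrB; congr (_%:~R / _).
    by rewrite -subzn// opprD addrACA (addrAC m) subrr add0r.
  rewrite -(@fsbig_widen _ _ _ _ (e @` `I_k.+1)%classic)//; last first.
    move=> r [_ /= rN]; apply/eqP; apply: contra_notT rN.
    rewrite mulf_eq0 negb_or => /andP[/of_ps_neq0[i rE] /of_ps_neq0[j qrE]].
    exists i => //=; rewrite ltnS.
    have : q = (m + m' + (i + j)%N%:Z)%:~R / n%:R.
      rewrite -(subrK r q) qrE rE -mulrDl -intrD; congr (_%:~R / _).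
      by rewrite PoszD addrC addrACA.
    rewrite qE => /(congr1 ( *%R^~ n%:R)); rewrite !divfK//.
    by move=> /intr_inj/addrI[->]; rewrite leq_addr.
  rewrite (@reindex_fsbig _ _ _ _ _ e `I_k.+1); last first.
    by split=> [i ik|i j _ _ /einj//|r [i ik <-]]; exists i.
  rewrite -(@fsbig_ord _ _ _ k.+1 (fun i =>
    of_ps n m u (e i) * of_ps n m' v (q - e i))).
  rewrite {2}qE of_psE// /psmul; apply: eq_bigr => i _.
  by rewrite /e of_psE// -/(e i) qe ?leq_ord// of_psE.
transitivity (0 : K); last first.
  by apply/esym/eqP; apply: contra_notT qN => /of_ps_neq0.
apply: fsbig1 => r _; apply/eqP; apply: contra_notT qN.
rewrite mulf_eq0 negb_or => /andP[/of_ps_neq0[i rE] /of_ps_neq0[j qrE]].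
exists (i + j)%N; rewrite -(subrK r q) qrE rE -mulrDl -intrD.
by congr (_%:~R / _); rewrite PoszD addrC addrACA.
Qed.

Lemma of_ps1 n : (0 < n)%N -> of_ps n 0 ps1 = (fun q => (q == 0)%:R).
Proof.
move=> n0; apply/funext => q; have [->|q0] := eqVneq q 0.
  have := @of_psE n 0 ps1 0%N n0.
  by rewrite addr0 mulr0z mul0r => ->.
apply/eqP; apply: contra_neqT q0 => qn; have [k qE] := of_ps_neq0 qn.
move: qn; rewrite qE of_psE// /ps1; case: k {qE} => [|k]; last by rewrite eqxx.
by rewrite addr0 mulr0z mul0r.
Qed.

Lemma is_puiseux0 : is_puiseux 0.
Proof. by exists 1%N, 0; split=> // q; rewrite eqxx. Qed.

Lemma is_puiseux1 : is_puiseux (fun q => (q == 0)%:R).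
Proof. by rewrite -(@of_ps1 1)//; exact: is_puiseux_of_ps. Qed.

Lemma is_puiseuxB f g : is_puiseux f -> is_puiseux g -> is_puiseux (f - g).
Proof.
move=> pf pg; have [n [m [u [v [_ [n0 -> -> _]]]]]] := puiseux_rep3 pf pg pg.
by rewrite -of_psN -of_psD; exact: is_puiseux_of_ps.
Qed.

Lemma is_puiseuxM f g : is_puiseux f -> is_puiseux g ->
  is_puiseux (puiseux_mul_fun f g).
Proof.
move=> pf pg; have [n [m [u [v [_ [n0 -> -> _]]]]]] := puiseux_rep3 pf pg pg.
by rewrite of_psM//; exact: is_puiseux_of_ps.
Qed.

Lemma is_puiseux_inv f : is_puiseux f -> f != 0 ->
  exists2 g, is_puiseux g & puiseux_mul_fun f g = (fun q => (q == 0)%:R).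
Proof.
move=> pf; have [n [m [u [_ [_ [n0 fE _ _]]]]]] := puiseux_rep3 pf pf pf.
move=> f0; have uN0 : exists k, u k != 0.
  apply/not_existsP => u0; move/eqP: f0; apply; rewrite fE.
  apply/funext => q; rewrite /of_ps /=; case: ifP => // _.
  by apply: contra_notP (u0 (Num.truncn (q * n%:R - m%:~R))) => /eqP.
case: (ex_minnP uN0) => k uk kmin.
have -> : f = of_ps n (m + k%:Z) (fun i => u (k + i)%N).
  have /laurent_inP -> // : laurent_in n (m + k%:Z) f.
    move=> q; rewrite fE => qn; have [i qE] := of_ps_neq0 qn.
    exists (m + i%:Z) => //; rewrite lerD2l lez_nat kmin//.
    by move: qn; rewrite qE of_psE.
  congr of_ps; apply/funext => i.
  by rewrite fE -addrA -PoszD of_psE.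
exists (of_ps n (- (m + k%:Z)) (psinv (fun i => u (k + i)%N))).
  exact: is_puiseux_of_ps.
by rewrite of_psM// psmulV ?addn0// subrr of_ps1.
Qed.

End PuiseuxRaw.

Section PuiseuxField.
Context (K : fieldType).

Definition puiseux_pred : {pred rat -> K} := fun f => `[< is_puiseux f >].

Lemma puiseux_zmod_closed : zmod_closed puiseux_pred.
Proof.
split=> [|f g /asboolP pf /asboolP pg]; apply/asboolP; first exact: is_puiseux0.
exact: is_puiseuxB.
Qed.
HB.instance Definition _ :=
  GRing.isZmodClosed.Build (rat -> K) puiseux_pred puiseux_zmod_closed.

Record puiseux := Puiseux {
  puiseux_coef :> rat -> K;
  _ : puiseux_coef \in puiseux_pred }.

HB.instance Definition _ := [isSub for puiseux_coef].
HB.instance Definition _ := [Choice of puiseux by <:].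
HB.instance Definition _ := [SubChoice_isSubZmodule of puiseux by <:].

Implicit Types f g h : puiseux.

Lemma puiseuxP f : is_puiseux f.
Proof. by case: f => f /= /asboolP. Qed.

Definition mk_puiseux (f : rat -> K) (pf : is_puiseux f) : puiseux :=
  Puiseux (asboolT pf : f \in puiseux_pred).

Definition puiseux_one : puiseux := mk_puiseux is_puiseux1.

Definition puiseux_mul f g : puiseux :=
  mk_puiseux (is_puiseuxM (puiseuxP f) (puiseuxP g)).

Lemma puiseux_mulA : associative puiseux_mul.
Proof.
move=> f g h; apply: val_inj => /=.
have [n [m [u [v [w [n0 -> -> ->]]]]]] :=
  puiseux_rep3 (puiseuxP f) (puiseuxP g) (puiseuxP h).
by rewrite !of_psM// psmulA addrA.
Qed.

Lemma puiseux_mulC : commutative puiseux_mul.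
Proof.
move=> f g; apply: val_inj => /=.
have [n [m [u [v [w [n0 -> -> _]]]]]] :=
  puiseux_rep3 (puiseuxP f) (puiseuxP g) (puiseuxP g).
by rewrite !of_psM// psmulC.
Qed.

Lemma puiseux_mul1 : left_id puiseux_one puiseux_mul.
Proof.
move=> f; apply: val_inj => /=.
have [n [m [u [v [w [n0 -> _ _]]]]]] :=
  puiseux_rep3 (puiseuxP f) (puiseuxP f) (puiseuxP f).
by rewrite -(of_ps1 n0) of_psM// add0r psmul1.
Qed.

Lemma puiseux_mulDl : left_distributive puiseux_mul +%R.
Proof.
move=> f g h; apply: val_inj => /=.
have [n [m [u [v [w [n0 -> -> ->]]]]]] :=
  puiseux_rep3 (puiseuxP f) (puiseuxP g) (puiseuxP h).
by rewrite -of_psD !of_psM// psmulDl of_psD.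
Qed.

Lemma puiseux_one_neq0 : puiseux_one != 0.
Proof.
apply/eqP => /(congr1 (fun f : puiseux => f 0)) /=.
by move=> /eqP; rewrite oner_eq0.
Qed.

HB.instance Definition _ := GRing.Zmodule_isComNzRing.Build puiseux
  puiseux_mulA puiseux_mulC puiseux_mul1 puiseux_mulDl puiseux_one_neq0.

Definition puiseux_inv f : puiseux := xget 0 [set g | g * f = 1]%classic.

Lemma puiseux_mulVf f : f != 0 -> puiseux_inv f * f = 1.
Proof.
move=> f0; have [] := @is_puiseux_inv _ f (puiseuxP f).
  by apply: contra_neq f0 => f0; exact: val_inj.
move=> g pg fg; suff : [set g | g * f = 1]%classic (puiseux_inv f) by [].
apply: xgetPex; exists (mk_puiseux pg).
by rewrite /= mulrC; exact: val_inj.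
Qed.

Lemma puiseux_inv0 : puiseux_inv 0 = 0.
Proof.
by apply: xgetPN => g /= /esym/eqP; rewrite mulr0 oner_eq0.
Qed.

HB.instance Definition _ :=
  GRing.ComNzRing_isField.Build puiseux puiseux_mulVf puiseux_inv0.

Lemma puiseux_monom_proof (q : rat) : is_puiseux (fun r => (r == q)%:R : K).
Proof.
exists `|denq q|%N, (numq q); split; first by rewrite absz_gt0 denq_neq0.
move=> r; have [-> _|] := eqVneq r q; last by rewrite eqxx.
by exists (numq q) => //; rewrite -[LHS]divq_num_den pmulrn absz_denq.
Qed.

(* x^q *)
Definition puiseux_monom (q : rat) : puiseux := mk_puiseux (@puiseux_monom_proof q).

Lemma puiseux_monomD (q r : rat) :
  puiseux_monom (q + r) = puiseux_monom q * puiseux_monom r.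
Proof.
apply: val_inj; apply/funext => s /=; rewrite /puiseux_mul_fun.
rewrite -(@fsbig_widen _ _ _ _ [set q]%classic)//; last first.
  by move=> t [_ /eqP/negPf tq]; rewrite /= tq mul0r.
by rewrite fsbig_set1 eqxx mul1r subr_eq addrC.
Qed.

End PuiseuxField.

Arguments puiseux_monom {K}.

Section QShift.
Context {R : realType} (alpha : {posnum R}).

Local Notation F := (puiseux R[i]).
Local Notation chi q := ((powR alpha%:num (ratr q))%:C%C : R[i]).

Lemma qshift_proof (f : F) : is_puiseux (fun q => chi q * f q).
Proof.
have [n [m [n0 nf]]] := puiseuxP f; exists n, m; split=> // q.
by rewrite mulf_eq0 negb_or => /andP[_ /nf].
Qed.

(* \sum_q f q x^q |-> \sum_q f q alpha^q x^q, where alpha^q > 0 *)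
Definition qshift (f : F) : F := mk_puiseux (qshift_proof f).

Lemma qshift_is_zmod_morphism : zmod_morphism qshift.
Proof. by move=> f g; apply: val_inj; apply/funext => q /=; rewrite mulrBr. Qed.

Lemma chiD (q r : rat) : chi (q + r) = chi q * chi r.
Proof.
rewrite -[RHS]rmorphM rmorphD /= powRD//.
by apply/implyP => _; rewrite gt_eqF.
Qed.

Lemma qshift_is_monoid_morphism : monoid_morphism qshift.
Proof.
split=> [|f g]; apply: val_inj; apply/funext => q /=.
  have [->|_] := eqVneq q 0; last by rewrite mulr0.
  by rewrite rmorph0 powRr0 mulr1.
rewrite /puiseux_mul_fun mulr_fsumr; apply: eq_fsbigr => r _.
by rewrite mulrACA -chiD (addrC r) subrK.
Qed.

HB.instance Definition _ := GRing.isZmodMorphism.Build F F qshift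
  qshift_is_zmod_morphism.
HB.instance Definition _ := GRing.isMonoidMorphism.Build F F qshift
  qshift_is_monoid_morphism.

Lemma qshift_monom (q r : rat) :
  qshift (puiseux_monom q) r = chi q * puiseux_monom q r.
Proof. by rewrite /=; have [->//|_] := eqVneq r q; rewrite !mulr0. Qed.

Lemma qshift_bij : bijective qshift.
Proof.
have chi0 q : chi q != 0 by rewrite fmorph_eq0 gt_eqF// powR_gt0.
have pf (f : F) : is_puiseux (fun q => (chi q)^-1 * f q).
  have [n [m [n0 nf]]] := puiseuxP f; exists n, m; split=> // q.
  by rewrite mulf_eq0 negb_or => /andP[_ /nf].
exists (fun f => mk_puiseux (pf f)) => f; apply: val_inj; apply/funext => q /=.
  by rewrite mulKf.
by rewrite mulVKf.
Qed.

End QShift.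

(* K[t, sigma]: the list [p] stands for \sum_i p`_i t^i, with coefficients on
   the left; only the product, [skew_mul], differs from that of [{poly K}]. *)
Definition skewpoly (K : fieldType) (sigma : {rmorphism K -> K}) := {poly K}.

Notation "{ 'skew' sigma }" := (skewpoly sigma)
  (format "{ 'skew'  sigma }") : type_scope.

Section SkewPolyRing.
Context (K : fieldType) (sigma : {rmorphism K -> K}).

HB.instance Definition _ := GRing.Zmodule.copy {skew sigma} {poly K}.

Implicit Types p q r : {poly K}.

(* t * p, that is, t a = sigma(a) t on each coefficient a of p *)
Definition skew_tmul p : {poly K} := map_poly sigma p * 'X.

Definition skew_mul p q : {poly K} :=
  \sum_(i < size p) p`_i *: iter i skew_tmul q.

Lemma skew_mul_widen N p q : (size p <= N)%N ->
  skew_mul p q = \sum_(i < N) p`_i *: iter i skew_tmul q.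
Proof.
move=> pN; rewrite /skew_mul (big_ord_widen _ (fun i => p`_i *: iter i skew_tmul q) pN).
rewrite big_mkcond; apply: eq_bigr => i _; case: ltnP => // pi.
by rewrite nth_default// scale0r.
Qed.

Lemma skew_tmulD p q : skew_tmul (p + q) = skew_tmul p + skew_tmul q.
Proof. by rewrite /skew_tmul rmorphD mulrDl. Qed.

Lemma skew_tmul0 : skew_tmul 0 = 0.
Proof. by rewrite /skew_tmul rmorph0 mul0r. Qed.

Lemma skew_tmulZ a p : skew_tmul (a *: p) = sigma a *: skew_tmul p.
Proof. by rewrite /skew_tmul map_polyZ scalerAl. Qed.

Lemma skew_mulDl : left_distributive skew_mul +%R.
Proof.
move=> p q r; pose N := maxn (size p) (size q).
rewrite !(@skew_mul_widen N) ?leq_maxl ?leq_maxr ?size_polyD// -big_split.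
by apply: eq_bigr => i _; rewrite coefD scalerDl.
Qed.

Lemma skew_mulDr : right_distributive skew_mul +%R.
Proof.
move=> p q r; rewrite /skew_mul -big_split /=; apply: eq_bigr => i _.
rewrite -scalerDr; congr (_ *: _); elim: (nat_of_ord i) => //= j ->.
by rewrite skew_tmulD.
Qed.

Lemma skew_mul0l p : skew_mul 0 p = 0.
Proof. by rewrite /skew_mul size_poly0 big_ord0. Qed.

Lemma skew_mulZl a p q : skew_mul (a *: p) q = a *: skew_mul p q.
Proof.
rewrite (@skew_mul_widen (size p)) ?size_scale_leq// /skew_mul scaler_sumr.
by apply: eq_bigr => i _; rewrite coefZ scalerA.
Qed.

Lemma skew_mul_tl p q : skew_mul (skew_tmul p) q = skew_tmul (skew_mul p q).
Proof.
rewrite (@skew_mul_widen (size p).+1); last first.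
  by rewrite (leq_trans (size_polyMleq _ _))// size_polyX addn2 /= ltnS size_poly.
rewrite big_ord_recl coefMX eqxx scale0r add0r.
rewrite /skew_mul (big_morph _ skew_tmulD skew_tmul0).
by apply: eq_bigr => i _; rewrite skew_tmulZ coefMX coef_map.
Qed.

Lemma skew_mulA : associative skew_mul.
Proof.
move=> p q r; rewrite [LHS]/skew_mul [skew_mul p q]/skew_mul.
rewrite (big_morph (skew_mul^~ r) (fun x y => skew_mulDl x y r) (skew_mul0l r)).
apply: eq_bigr => i _; rewrite skew_mulZl; congr (_ *: _).
by elim: (nat_of_ord i) => //= j IH; rewrite skew_mul_tl IH.
Qed.

Lemma skew_mul1l : left_id (1 : {poly K}) skew_mul.
Proof.
move=> p; rewrite /skew_mul size_poly1 big_ord1 coef1 scale1r.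
by [].
Qed.

Lemma skew_mul1r : right_id (1 : {poly K}) skew_mul.
Proof.
move=> p; rewrite -[RHS]coefK poly_def; apply: eq_bigr => i _.
congr (_ *: _); elim: (nat_of_ord i) => //= j ->.
by rewrite /skew_tmul map_polyXn exprSr.
Qed.

HB.instance Definition _ := GRing.Zmodule_isNzRing.Build {skew sigma}
  skew_mulA skew_mul1l skew_mul1r skew_mulDl skew_mulDr (oner_neq0 {poly K}).

End SkewPolyRing.

Section SkewPolyTheory.
Context (K : fieldType) (sigma : {rmorphism K -> K}).

Definition skewC (a : K) : {skew sigma} := a%:P.
Definition skewT : {skew sigma} := 'X.

Lemma skewT_mulC (a : K) : skewT * skewC a = skewC (sigma a) * skewT.
Proof.
rewrite /GRing.mul /= /skew_mul size_polyX big_ord_recl big_ord1 !coefX/=.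
rewrite scale0r add0r scale1r size_polyC.
have [->|a0] := eqVneq a 0.
  by rewrite rmorph0 eqxx big_ord0 /skew_tmul rmorph0 mul0r.
by rewrite fmorph_eq0 a0 big_ord1 coefC /= /skew_tmul map_polyC mul_polyC.
Qed.

Lemma skewpolyE (p : {skew sigma}) :
  p = \sum_(i < size (p : {poly K})) skewC (p : {poly K})`_i * skewT ^+ i.
Proof.
suff skewXn i : skewT ^+ i = 'X^i :> {poly K}.
  rewrite -[LHS](coefK (p : {poly K})) poly_def; apply: eq_bigr => i _.
  rewrite /GRing.mul /= /skew_mul /skewC size_polyC skewXn.
  have [->|_] := eqVneq; first by rewrite big_ord0 scale0r.
  by rewrite big_ord1 coefC.
elim: i => // i IH; rewrite exprS IH /GRing.mul /= /skew_mul /skewT size_polyX.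
rewrite big_ord_recl big_ord1 !coefX/= scale0r add0r scale1r /skew_tmul.
by rewrite map_polyXn exprSr.
Qed.

Definition sigma_zero (p : {skew sigma}) (a : K) : Prop :=
  exists g : {skew sigma}, p = g * (skewT - skewC a).

(* [size] is the degree plus one *)
Definition sigma_closed : Prop :=
  forall p : {skew sigma}, (1 < size (p : {poly K}))%N ->
  exists2 s : seq {skew sigma},
    all (fun l => size (l : {poly K}) == 2) s & p = \prod_(l <- s) l.

End SkewPolyTheory.

Arguments skewC {K sigma}.
Arguments skewT {K sigma}.
Arguments sigma_zero {K sigma}.

(* Main.v *)
(* Uniqueness of the zero: if [b = a - 1 <> 0] and [a] is a zero of [(t - 1)^2],
   then [sigma b * b + sigma b - b = 0], so [w = 1/b] satisfies
   [sigma w = w + 1]; this is impossible, as [sigma] fixes the coefficient at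
   the exponent [0].

   Closedness, for [alpha > 1]: by right division it is enough to find a zero of
   [\sum_i f_i t^i] with [f_0 <> 0].  Look for one of the form
   [c x^mu (sigma u / u)] with [u = 1 + ...]; the equation then becomes linear
   in [u].  With [mu] a slope of the Newton polygon, its lowest terms give a
   polynomial [P] with at least two nonzero coefficients, and the coefficient of
   [x^(m/n)] in [u] is determined by the previous ones as soon as
   [P(c alpha^(m/n)) <> 0].  Take for [c] a root of [P] of maximal modulus. *)
Require Import Defs.
From mathcomp Require Import all_boot all_order all_algebra.
From mathcomp Require Import boolp classical_sets functions fsbigop.
From mathcomp Require Import reals exp interval_inference complex ring lra.

Set Implicit Arguments.
Unset Strict Implicit.
Unset Printing Implicit Defensive.

Import Order.TTheory GRing.Theory Num.Theory.

Local Open Scope ring_scope.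

(** * Evaluation of skew polynomials and right division by [t - a] *)

Section SkewEvaluation.
Context (K : fieldType) (sigma : {rmorphism K -> K}).
Implicit Types (a b : K) (i : nat) (p g h : {poly K}).

(** The skew analogue of the power [a ^+ i]: the remainder of [t^i] on right division by [t - a]. *)
Definition sigma_norm a i : K := \prod_(j < i) iter j sigma a.

Lemma sigma_norm0 a : sigma_norm a 0 = 1.
Proof. by rewrite /sigma_norm big_ord0. Qed.

Lemma sigma_normS a i : sigma_norm a i.+1 = sigma_norm a i * iter i sigma a.
Proof. by rewrite /sigma_norm big_ord_recr. Qed.

Lemma sigma_normSl a i : sigma_norm a i.+1 = sigma (sigma_norm a i) * a.
Proof.
by rewrite /sigma_norm big_ord_recl mulrC rmorph_prod.
Qed.

Lemma iter_sigmaM a b i :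
  iter i sigma (a * b) = iter i sigma a * iter i sigma b.
Proof. by elim: i => //= i ->; rewrite rmorphM. Qed.

Lemma iter_sigma_eq0 a i : (iter i sigma a == 0) = (a == 0).
Proof. by elim: i => //= i <-; rewrite fmorph_eq0. Qed.

Lemma sigma_normM a b i :
  sigma_norm (a * b) i = sigma_norm a i * sigma_norm b i.
Proof.
by rewrite /sigma_norm -big_split; apply: eq_bigr => j _; exact: iter_sigmaM.
Qed.

(** The product telescopes. This is what makes the equation for a zero linear in [u] when the zero
    is sought as a multiple of [sigma u / u]. *)
Lemma sigma_norm_coboundary u i : u != 0 ->
  sigma_norm (sigma u / u) i = iter i sigma u / u.
Proof.
move=> u0; elim: i => [|i IH]; first by rewrite sigma_norm0 divff.
rewrite sigma_normS IH iter_sigmaM -iterSr /= mulrC.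
suff -> : iter i sigma u^-1 = (iter i sigma u)^-1.
  by rewrite mulrA mulrVK// unitfE iter_sigma_eq0.
by elim: i {IH} => //= i ->; rewrite fmorphV.
Qed.

Definition skew_eval a p : K := \sum_(i < size p) p`_i * sigma_norm a i.

Lemma skew_eval_widen N a p : (size p <= N)%N ->
  skew_eval a p = \sum_(i < N) p`_i * sigma_norm a i.
Proof.
move=> pN; rewrite /skew_eval.
rewrite (big_ord_widen _ (fun i => p`_i * sigma_norm a i) pN).
rewrite big_mkcond; apply: eq_bigr => i _; case: ltnP => // pi.
by rewrite nth_default// mul0r.
Qed.

Lemma skew_evalD a p g : skew_eval a (p + g) = skew_eval a p + skew_eval a g.
Proof.
pose N := maxn (size p) (size g).
rewrite !(@skew_eval_widen N) ?leq_maxl ?leq_maxr ?size_polyD// -big_split.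
by apply: eq_bigr => i _; rewrite coefD mulrDl.
Qed.

Lemma skew_evalZ a b p : skew_eval a (b *: p) = b * skew_eval a p.
Proof.
rewrite (@skew_eval_widen (size p)) ?size_scale_leq// mulr_sumr.
by apply: eq_bigr => i _; rewrite coefZ mulrA.
Qed.

Lemma skew_eval_tmul a p :
  skew_eval a (skew_tmul sigma p) = sigma (skew_eval a p) * a.
Proof.
rewrite (@skew_eval_widen (size p).+1); last first.
  by rewrite (leq_trans (size_polyMleq _ _))// size_polyX addn2 /= ltnS
    size_poly.
rewrite big_ord_recl coefMX eqxx mul0r add0r rmorph_sum mulr_suml.
apply: eq_bigr => i _; rewrite lift0 coefMX coef_map sigma_normSl rmorphM.
by rewrite mulrA.
Qed.

(** Skew evaluation is not multiplicative, but left multiplication by a scalar or by [t] preserves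
    its vanishing, and these two generate all left multiples. *)
Lemma skew_eval_mul_eq0 a g h :
  skew_eval a h = 0 -> skew_eval a (skew_mul sigma g h) = 0.
Proof.
move=> h0; rewrite /skew_mul.
have e0 : skew_eval a 0 = 0 by rewrite /skew_eval size_poly0 big_ord0.
rewrite (big_morph (skew_eval a) (skew_evalD a) e0) big1// => i _.
rewrite skew_evalZ; suff -> : skew_eval a (iter i (skew_tmul sigma) h) = 0.
  by rewrite mulr0.
by elim: (nat_of_ord i) => //= j IH; rewrite skew_eval_tmul IH rmorph0 mul0r.
Qed.

Lemma skew_mulCl a p : (skewC a : {skew sigma}) * (p : {skew sigma}) = a *: p.
Proof.
rewrite /GRing.mul /= /skewC -(mulr1 a%:P) mul_polyC skew_mulZl.
by rewrite skew_mul1l.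
Qed.

Lemma skewTXn i : (skewT : {skew sigma}) ^+ i = 'X^i :> {poly K}.
Proof.
elim: i => // i IH; rewrite exprS IH /GRing.mul /= /skew_mul size_polyX.
rewrite big_ord_recl big_ord1 !coefX /= scale0r add0r scale1r /skew_tmul.
by rewrite map_polyXn exprSr.
Qed.

Lemma size_skew_mul_leq g h :
  (size (skew_mul sigma g h) <= (size g + size h).-1)%N.
Proof.
have size_iter_tmul j : (size (iter j (skew_tmul sigma) h) <= j + size h)%N.
  elim: j => // j IH; rewrite iterS /skew_tmul.
  rewrite (leq_trans (size_polyMleq _ _))// size_polyX addn2 /= addSn ltnS.
  by rewrite (leq_trans (size_poly _ _)).
rewrite /skew_mul; apply: (big_ind (fun p : {poly K} => size p <= _)%N).
- by rewrite size_poly0.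
- by move=> p q sp sq; rewrite (leq_trans (size_polyD _ _))// geq_max sp.
move=> i _; rewrite (leq_trans (size_scale_leq _ _))//.
rewrite (leq_trans (size_iter_tmul i))//.
by case: (size g) i => [[]//|n] i; rewrite addSn /= leq_add2r -ltnS.
Qed.

Lemma skewT_subC (a : K) :
  (skewT - skewC a : {skew sigma}) = ('X - a%:P : {poly K}).
Proof. by []. Qed.

(** Writing [N_i] for the norms, [t^(i+1) - N_(i+1) = t (t^i - N_i) + sigma(N_i) (t - a)], because
    [t N_i = sigma(N_i) t]. The size bound serves the later induction on the degree. *)
Lemma skew_pow_div a i : exists g : {poly K}, (size g <= i)%N /\
  (skewT : {skew sigma}) ^+ i - skewC (sigma_norm a i)
    = (g : {skew sigma}) * (skewT - skewC a).
Proof.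
elim: i => [|i [g [gi gE]]].
  by exists 0; rewrite size_poly0 sigma_norm0 subrr mul0r.
exists ((skewT : {skew sigma}) * g + skewC (sigma (sigma_norm a i))).
split.
  rewrite (leq_trans (size_polyD _ _))// geq_max; apply/andP; split.
    rewrite (leq_trans (size_skew_mul_leq _ _))//.
    by rewrite /skewT size_polyX add2n.
  by rewrite (leq_trans (size_polyC_leq1 _)).
rewrite mulrDl -mulrA -gE exprS !mulrBr skewT_mulC.
have -> : skewC (sigma (sigma_norm a i)) * skewC a
  = skewC (sigma_norm a i.+1) :> {skew sigma}.
  by rewrite skew_mulCl sigma_normSl /skewC -mul_polyC -polyCM.
by rewrite addrA subrK.
Qed.

(** Dividing each [t^i] separately and combining with the coefficients of [p] leaves [skew_eval a p]
    as total remainder. *)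
Lemma skew_eval_eq0_div a p : skew_eval a p = 0 ->
  exists2 g : {poly K}, (size g <= (size p).-1)%N &
    p = (g : {skew sigma}) * (skewT - skewC a) :> {skew sigma}.
Proof.
move=> pa0.
have [g gP] := choice (fun i => skew_pow_div a i).
pose q : {skew sigma} := \sum_(i < size p) (skewC p`_i : {skew sigma}) * g i.
exists q.
  apply: (big_ind (fun p : {poly K} => size p <= _)%N).
  - by rewrite size_poly0.
  - by move=> r s sr ss; rewrite (leq_trans (size_polyD _ _))// geq_max sr.
  move=> i _; rewrite skew_mulCl (leq_trans (size_scale_leq _ _))//.
  rewrite (leq_trans (gP i).1)//.
  by case: (size p) i => [[]//|n] i; rewrite -ltnS.
rewrite /q mulr_suml.
under eq_bigr do rewrite -mulrA -(gP _).2 mulrBr.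
rewrite sumrB -(skewpolyE (p : {skew sigma})) -[LHS]subr0; congr (_ - _).
transitivity ((skew_eval a p)%:P : {poly K}); first by rewrite pa0 polyC0.
rewrite /skew_eval (raddf_sum polyC); apply: (@eq_bigr {poly K}) => i _.
by rewrite skew_mulCl /skewC -mul_polyC -polyCM.
Qed.

Lemma sigma_zeroP (p : {skew sigma}) a : sigma_zero p a <-> skew_eval a p = 0.
Proof.
split=> [[g ->]|/skew_eval_eq0_div[g _ ->]]; last by exists g.
apply: skew_eval_mul_eq0; rewrite skewT_subC /skew_eval size_XsubC.
rewrite big_ord_recl big_ord1 !coefB !coefX !coefC /= sigma_norm0.
by rewrite sigma_normS sigma_norm0 /= subr0 sub0r !mul1r mulr1 addNr.
Qed.

Lemma skewT_sub1_sqr :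
  (skewT - 1) ^+ 2 = skewT ^+ 2 - skewC 2 * skewT + 1 :> {skew sigma}.
Proof.
rewrite sqrrB1; congr (_ - _ + _).
by rewrite skew_mulCl scaler_nat.
Qed.

Lemma skewT_sub1_sqr_poly :
  (skewT - 1 : {skew sigma}) ^+ 2 = 'X^2 - 2 *: 'X + 1 :> {poly K}.
Proof. by rewrite skewT_sub1_sqr skewTXn skew_mulCl. Qed.

Lemma size_skewT_sub1_sqr : size ('X^2 - 2 *: 'X + 1 : {poly K}) = 3.
Proof.
rewrite -addrA size_polyDl size_polyXn// ltnS.
rewrite (leq_trans (size_polyD _ _))// size_poly1 size_polyN geq_max andbT.
by rewrite (leq_trans (size_scale_leq _ _))// size_polyX.
Qed.

Lemma sigma_zero_skewT_sub1_sqr a :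
  sigma_zero ((skewT - 1) ^+ 2 : {skew sigma}) a <->
  sigma a * a - 2 * a + 1 = 0.
Proof.
rewrite sigma_zeroP skewT_sub1_sqr_poly /skew_eval size_skewT_sub1_sqr.
rewrite !big_ord_recl big_ord0 !coefE /= !sigma_normSl sigma_norm0.
rewrite !rmorph1 !mul1r !(mulr0,subr0,add0r,addr0,mulr1,sub0r,mul1r).
by rewrite oppr0 add0r addrC ?mulNr [_ + sigma a * a]addrC.
Qed.

(** Each zero splits off a linear right factor; induction on the degree factors the left
    quotient. *)
Lemma sigma_closed_of_zeros :
  (forall p, (1 < size p)%N -> exists a, skew_eval a p = 0) ->
  sigma_closed sigma.
Proof.
move=> ex_zero p; move: {2}(size _) (leqnn (size (p : {poly K}))) => n.
elim: n p => [|n IH] p; first by rewrite leqn0 => /eqP ->.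
move=> pn p1; have [sp2|sp2] := eqVneq (size (p : {poly K})) 2.
  by exists [:: p]; rewrite /= ?sp2// big_seq1.
have [a /skew_eval_eq0_div[g gp pE]] := ex_zero _ p1.
(* The quotient loses no more than one degree, so it is non-constant unless [p] is itself linear. *)
have sg : (size (p : {poly K}) <= (size g).+1)%N.
  by rewrite pE (leq_trans (size_skew_mul_leq _ _))// skewT_subC
    size_XsubC addn2.
have [||s sl gE] := IH g.
- by rewrite (leq_trans gp)// -ltnS prednK// ltnW.
- by rewrite -ltnS (leq_trans _ sg)// ltn_neqAle eq_sym sp2.
exists (rcons s (skewT - skewC a)).
  by rewrite all_rcons sl andbT skewT_subC size_XsubC.
by rewrite big_rcons /= -gE.
Qed.

End SkewEvaluation.

(** * Recursive solution of linear q-difference equations in power series *)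

Lemma course_of_values_rec_ex (A : Type) (a0 : A)
    (Phi : nat -> (nat -> A) -> A) :
  (forall m u v, (forall k, (k < m)%N -> u k = v k) -> Phi m u = Phi m v) ->
  exists u, forall m, u m = Phi m u.
Proof.
move=> PhiE.
(* [approx m] is correct below [m] and has the dummy value [a0] from [m] on; the solution is read
   off the diagonal. *)
pose approx := fix approx m : nat -> A := if m is m'.+1 then
  fun k => if k == m' then Phi m' (approx m') else approx m' k else fun=> a0.
have approxE m k : (k < m)%N -> approx m k = approx k.+1 k.
  elim: m => // m IH; rewrite ltnS leq_eqVlt => /predU1P[->//|km].
  by rewrite [LHS]/= ltn_eqF// IH.
exists (fun k => approx k.+1 k) => m; rewrite /= eqxx; apply: PhiE => k km.
by rewrite approxE.
Qed.

Lemma max_norm_ex (C : numDomainType) (x : C) (s : seq C) :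
  exists2 z, z \in x :: s & {in x :: s, forall y, `|y| <= `|z|}.
Proof.
elim: s x => [|y s IH] x.
  by exists x; rewrite ?mem_head// => y; rewrite inE => /eqP ->.
have [z zs zmax] := IH y.
(* The order on [C] is only partial, but norms are real and hence comparable. *)
have /orP[xz|zx] := real_leVge (normr_real x) (normr_real z).
  exists z; first by rewrite inE zs orbT.
  by move=> w; rewrite inE => /predU1P[->//|/zmax].
exists x; first exact: mem_head.
move=> w; rewrite inE => /predU1P[->//|/zmax wz].
exact: le_trans zx.
Qed.

(** A root [c] of maximal modulus works: it is nonzero since [P.[0] != 0], so [c * q ^+ m] has
    strictly larger modulus. *)
Lemma root_no_dilate (C : numClosedFieldType) (q : C) (P : {poly C}) :
  1 < q -> (1 < size P)%N -> P.[0] != 0 ->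
  exists2 c, root P c & forall m, (0 < m)%N -> ~~ root P (c * q ^+ m).
Proof.
move=> q1 sP P0; have [[|x s] PE] := closed_field_poly_normal P.
  by move: sP; rewrite PE big_nil ltnNge (leq_trans (size_scale_leq _ _))//
    size_poly1.
have PN0 : P != 0 by rewrite -size_poly_gt0 ltnW.
have rootE y : root P y = (y \in x :: s).
  by rewrite PE rootZ ?lead_coef_eq0// root_prod_XsubC.
have [c cs cmax] := max_norm_ex x s.
have c0 : c != 0.
  by apply: contra_neq P0 => cE; move: cs; rewrite -rootE cE => /eqP.
exists c => [|m m0]; first by rewrite rootE.
rewrite rootE; apply/negP => /cmax.
rewrite normrM normrX (gtr0_norm (lt_trans ltr01 q1)).
rewrite -[leRHS]mulr1 ler_pM2l ?normr_gt0//.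
by rewrite lt_geF// exprn_egt1// -lt0n.
Qed.

(** The sum is the coefficient of degree [m] in [\sum_i c^i G_i tau^i(u)], where [tau] scales the
    coefficient of degree [k] by [q ^+ k]. *)
Lemma qdifference_solution (C : numClosedFieldType) (q : C) (d : nat)
    (G : nat -> nat -> C) :
  1 < q -> G 0%N 0%N != 0 -> (exists2 i, (0 < i < d)%N & G i 0%N != 0) ->
  exists c (u : nat -> C), u 0%N = 1 /\ forall m,
    \sum_(i < d) c ^+ i * psmul (G i) (fun k => q ^+ (i * k) * u k) m = 0.
Proof.
move=> q1 G00 [i0 /andP[i00 i0d] Gi0].
(* The degree [j] coefficients of all the series [G i], collected as a polynomial in an auxiliary
   variable to be evaluated at [c * q ^+ k]. *)
pose P j := \poly_(i < d) G i j.
have [||c Pc Pcq] := @root_no_dilate C q (P 0%N) q1.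
- rewrite ltnNge; apply: contra_neqN Gi0 => sP.
  have : (P 0%N)`_i0 = 0 by rewrite nth_default// (leq_trans sP).
  by rewrite coef_poly i0d.
- by rewrite horner_coef0 coef_poly (leq_trans _ i0d).
(* Equation [m] solved for [u m]. Equation [0] reads [u 0 * (P 0).[c] = 0], which holds for any
   [u 0] since [c] is a root; the value [1] is a normalization. *)
pose Phi m (u : nat -> C) := if m is 0%N then 1 else
  - (\sum_(k < m) u k * (P (m - k)%N).[c * q ^+ k]) / (P 0%N).[c * q ^+ m].
have [u uE] : exists u, forall m, u m = Phi m u.
  apply: (course_of_values_rec_ex 0) => -[//|m] u v uv; rewrite /Phi.
  by congr (- _ / _); apply: eq_bigr => k _; rewrite uv.
exists c, u; split=> // m.
transitivity (\sum_(k < m.+1) u k * (P (m - k)%N).[c * q ^+ k]).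
  under eq_bigr do rewrite psmulC /psmul mulr_sumr.
  rewrite exchange_big /=; apply: eq_bigr => k _.
  rewrite horner_poly mulr_sumr; apply: eq_bigr => i _.
  by rewrite exprMn -exprM (mulnC k); ring.
rewrite big_ord_recr /= subnn; case: m => [|m].
  by rewrite big_ord0 expr0 mulr1 (eqP Pc) mulr0 addr0.
by rewrite [u m.+1]uE /Phi divfK ?subrr//; exact: Pcq.
Qed.

(** * Monomials, valuations and common denominators of Puiseux series *)

Section PuiseuxTerms.
Context {K : fieldType}.
Implicit Types (f : puiseux K) (c : K) (q r : rat).

Definition puiseux_term_fun c q : rat -> K := fun r => c * puiseux_monom q r.

Lemma is_puiseux_term c q : is_puiseux (puiseux_term_fun c q).
Proof.
have [n [m [n0 nf]]] := puiseuxP (@puiseux_monom K q).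
exists n, m; split=> // r.
by rewrite mulf_eq0 negb_or => /andP[_ /nf].
Qed.

Definition puiseux_term c q : puiseux K := mk_puiseux (is_puiseux_term c q).

Lemma puiseux_termE c q f r : (puiseux_term c q * f) r = c * f (r - q).
Proof.
rewrite /= /puiseux_mul_fun.
rewrite -(@fsbig_widen _ _ _ _ [set q]%classic)//; last first.
  by move=> t [_ /eqP/negPf tq]; rewrite /= /puiseux_term_fun /= tq mulr0 mul0r.
by rewrite fsbig_set1 /= /puiseux_term_fun /= eqxx mulr1.
Qed.

Lemma puiseux_termM c c' q r :
  puiseux_term c q * puiseux_term c' r = puiseux_term (c * c') (q + r).
Proof.
apply: val_inj; apply/funext => s; rewrite [LHS]puiseux_termE /=.
by rewrite /puiseux_term_fun mulrA /= subr_eq addrC.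
Qed.

Lemma puiseux_term1 : puiseux_term 1 0 = 1.
Proof.
by apply: val_inj; apply/funext => s /=; rewrite /puiseux_term_fun mul1r.
Qed.

Lemma puiseux_sumE (d : nat) (h : 'I_d -> puiseux K) r :
  (\sum_(i < d) h i) r = \sum_(i < d) h i r.
Proof. exact: (big_morph (fun f : puiseux K => f r)). Qed.

(** The support lies in some [(1/n)Z] and is bounded below, so it has a least element. *)
Lemma puiseux_valuation_ex f : f != 0 ->
  exists v, f v != 0 /\ forall r, r < v -> f r = 0.
Proof.
move=> f0; have [n [m [n0 nf]]] := puiseuxP f.
have n0' : 0 < n%:R :> rat by rewrite ltr0n.
have fE := laurent_inP n0 nf.
have exk : exists k : nat, f ((m + k%:Z)%:~R / n%:R) != 0.
  apply/not_existsP => fk; move/eqP: f0; apply.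
  apply: val_inj; apply/funext => q.
  rewrite /= fE /of_ps; case: ifP => // _.
  by apply: contra_notP (fk (Num.truncn (q * n%:R - m%:~R))) => /eqP.
have [k fk kmin] := ex_minnP exk.
exists ((m + k%:Z)%:~R / n%:R); split=> // r rk.
apply/eqP; apply: contraLR rk => fr.
have [j mj rE] := nf _ fr; rewrite -leNgt rE ler_pM2r ?invr_gt0// ler_int.
have [l jE] : exists l : nat, j = m + l%:Z.
  by exists `|j - m|%N; rewrite gez0_abs ?subr_ge0// addrCA subrr addr0.
by rewrite jE lerD2l lez_nat kmin// -jE -rE.
Qed.

Lemma laurent_in0 n m (f : rat -> K) : (0 < n)%N ->
  (forall r, r < 0 -> f r = 0) -> laurent_in n m f -> laurent_in n 0 f.
Proof.
move=> n0 f0 nf r fr; have [j _ rE] := nf _ fr; exists j => //.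
have : 0 <= r by rewrite leNgt; apply: contraNN fr => /f0 ->.
by rewrite rE pmulr_lge0 ?invr_gt0 ?ltr0n// ler0z.
Qed.

Lemma common_denominator (f : nat -> puiseux K) (d : nat) :
  exists2 n, (0 < n)%N & forall i, (i < d)%N -> exists m, laurent_in n m (f i).
Proof.
elim: d => [|d [n n0 nf]]; first by exists 1%N.
have [n' [m' [n'0 nfd]]] := puiseuxP (f d).
exists (n * n')%N; first by rewrite muln_gt0 n0.
move=> i; rewrite ltnS leq_eqVlt => /predU1P[->|/nf[m nfi]].
  by rewrite mulnC; exists (m' * n%:Z); exact: laurent_in_mul.
by exists (m * n'%:Z); exact: laurent_in_mul.
Qed.

End PuiseuxTerms.

(* [mu] is a slope of the Newton polygon adjacent to the vertex at [0]. *)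
Lemma newton_slope_ex (d : nat) (P : pred nat) (v : nat -> rat) :
  (exists2 i, (0 < i < d)%N & P i) ->
  exists mu, (forall i, (i < d)%N -> P i -> v 0%N <= v i + mu * i%:R) /\
    exists2 i, (0 < i < d)%N & P i /\ v 0%N = v i + mu * i%:R.
Proof.
move=> [i0 /andP[i00 i0d] Pi0].
pose Q (i : 'I_d) := (0 < i)%N && P i.
have Q0 : Q (Ordinal i0d) by rewrite /Q i00.
(* For [i > 0] the required inequality says that [mu] is at least [(v 0 - v i) / i]; the maximum of
   these quotients is admissible and attains equality. *)
have [j /andP[j0 Pj] jmax] :=
  arg_maxP (fun i : 'I_d => (v 0%N - v i) / (i : nat)%:R) Q0.
exists ((v 0%N - v j) / (j : nat)%:R); split; last first.
  exists j; first by rewrite j0 ltn_ord.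
  by split=> //; rewrite divfK ?pnatr_eq0 -?lt0n// addrC subrK.
move=> [|i] id Pi; first by rewrite mulr0 addr0.
by rewrite addrC -lerBlDr -ler_pdivrMr ?ltr0n//; exact: (jmax (Ordinal id)).
Qed.

(** * Existence of zeros over the Puiseux field, for [alpha > 1] *)

Section QShiftZeros.
Context {R : realType} (alpha : {posnum R}).
Local Notation F := (puiseux R[i]).
Local Notation sigma := (qshift alpha : {rmorphism F -> F}).
Local Notation chi q := ((powR alpha%:num (ratr q))%:C%C : R[i]).

Lemma chi_neq0 (q : rat) : chi q != 0.
Proof. by rewrite fmorph_eq0 gt_eqF// powR_gt0. Qed.

Lemma chi0 : chi 0 = 1.
Proof. by rewrite rmorph0 powRr0. Qed.

Lemma chi_nat_div (n k : nat) : chi (k%:R / n%:R) = chi (n%:R^-1) ^+ k.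
Proof.
by rewrite -rmorphXn /= rmorphM /= ratr_nat mulrC powRrM powR_mulrn ?powR_ge0.
Qed.

Lemma chi_gt1 (n : nat) : 1 < alpha%:num -> (0 < n)%N -> 1 < chi (n%:R^-1).
Proof.
move=> a1 n0; rewrite -(rmorph1 (real_complex R)) ltcR.
rewrite ltNge; apply/negP => le1.
have := @exprn_ile1 _ n _ (powR_ge0 _ _) le1.
rewrite -powR_mulrn ?powR_ge0// -powRrM.
have -> : ratr n%:R^-1 * n%:R = 1 :> R.
  by rewrite -[X in _ * X]ratr_nat -rmorphM mulVf ?rmorph1// pnatr_eq0 -lt0n.
by rewrite powRr1// leNgt a1.
Qed.

Lemma iter_qshift (i : nat) (f : F) (q : rat) :
  iter i sigma f q = chi q ^+ i * f q.
Proof.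
elim: i => [|i IH]; first by rewrite mul1r.
by rewrite iterS [LHS]/= IH exprS mulrA.
Qed.

Lemma qshift_term c q : sigma (puiseux_term c q) = puiseux_term (chi q * c) q.
Proof.
apply: val_inj; apply/funext => r /=; rewrite /puiseux_term_fun /=.
by have [->|] := eqVneq r q; rewrite ?mulr0 ?mulr1.
Qed.

(** The scalar [alpha^(mu i(i-1)/2)], which arises because the [j]-th iterate of [sigma] multiplies
    [x^mu] by [alpha^(mu j)]. *)
Definition term_twist (mu : rat) (i : nat) : R[i] := \prod_(j < i) chi mu ^+ j.

Lemma term_twist_neq0 mu i : term_twist mu i != 0.
Proof. by apply/prodf_neq0 => j _; rewrite expf_neq0// chi_neq0. Qed.

Lemma sigma_norm_term c mu i :
  sigma_norm sigma (puiseux_term c mu) i =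
  puiseux_term (c ^+ i * term_twist mu i) (mu * i%:R).
Proof.
elim: i => [|i IH].
  by rewrite sigma_norm0 /term_twist big_ord0 mulr0 mulr1 puiseux_term1.
have iterE : iter i sigma (puiseux_term c mu) =
    puiseux_term (chi mu ^+ i * c) mu.
  elim: i {IH} => [|i IH]; first by rewrite mul1r.
  by rewrite iterS IH qshift_term exprS mulrA.
rewrite sigma_normS IH iterE puiseux_termM /term_twist big_ord_recr /=.
congr puiseux_term; first by rewrite exprS; ring.
by rewrite -[in RHS]addn1 natrD mulrDr mulr1.
Qed.

(** Over a common denominator [n] the [h i] become power series in [x^(1/n)], on which [sigma] acts
    as the dilation by [q = alpha^(1/n) > 1]. *)
Lemma qdifference_puiseux_solution (d : nat) (h : nat -> F) :
  1 < alpha%:num ->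
  (forall i r, (i < d)%N -> r < 0 -> h i r = 0) -> h 0%N 0 != 0 ->
  (exists2 i, (0 < i < d)%N & h i 0 != 0) ->
  exists (c : R[i]) (u : F), u != 0 /\
    \sum_(i < d) puiseux_term (c ^+ i) 0 * (h i * iter i sigma u) = 0.
Proof.
move=> a1 hneg h0 [i0 i0d hi0].
have [n n0 nh] := common_denominator h d.
pose G i k := h i ((0 + k%:Z)%:~R / n%:R).
have hE i : (i < d)%N -> h i = of_ps n 0 (G i) :> (rat -> _).
  move=> id; have [m nhi] := nh i id; apply: laurent_inP => //.
  by apply: laurent_in0 nhi => // r; exact: hneg.
have G0 i : G i 0%N = h i 0 by rewrite /G addr0 mul0r.
have [||c [u [u0 uE]]] :=
    @qdifference_solution _ (chi (n%:R^-1)) d G (chi_gt1 a1 n0).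
- by rewrite G0.
- by exists i0; rewrite ?G0.
pose U := mk_puiseux (is_puiseux_of_ps 0 u n0).
have UE i : iter i sigma U = of_ps n 0 (fun k => chi (n%:R^-1) ^+ (i * k) * u k)
    :> (rat -> _).
  apply/funext => r; rewrite iter_qshift /= /of_ps.
  case: ifP => [/eqP rE|]; last by rewrite mulr0.
  by rewrite {1}rE add0r -pmulrn chi_nat_div -exprM mulnC.
exists c, U; split.
  apply/eqP => /(congr1 (fun f : F => f 0)) /=.
  have := @of_psE R[i] n 0 u 0 n0; rewrite addr0 mul0r => -> /eqP.
  by rewrite u0 oner_eq0.
apply: val_inj; apply/funext => r; rewrite [LHS]puiseux_sumE.
transitivity (\sum_(i < d) c ^+ i *
    of_ps n 0 (psmul (G i) (fun k => chi (n%:R^-1) ^+ (i * k) * u k)) r).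
  apply: eq_bigr => i _; rewrite puiseux_termE subr0 /=.
  by rewrite (hE i (ltn_ord i)) UE of_psM// addr0.
rewrite /of_ps /=; case: (r == _); first exact: uE.
by apply: big1 => i _; rewrite mulr0.
Qed.

Lemma skew_eval_zero_ex (p : {poly F}) : 1 < alpha%:num -> (1 < size p)%N ->
  exists a, skew_eval sigma a p = 0.
Proof.
move=> a1 sp; have sp0 : (0 < size p)%N by exact: ltnW.
(* Without constant term, [0] is a zero, as all its norms of positive index vanish. *)
have [p00|p00] := eqVneq p`_0 0.
  exists 0; rewrite /skew_eval big1// => -[[|i] id] _ /=.
    by rewrite p00 mul0r.
  by rewrite sigma_normSl !mulr0.
have /choice[v vP] : forall i : nat, exists v, p`_i != 0 ->
    p`_i v != 0 /\ forall r, r < v -> p`_i r = 0.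
  move=> i; have [->|/puiseux_valuation_ex[v vP]] := eqVneq p`_i 0.
    by exists 0.
  by exists v.
have [|mu [mumin [i0 i0d [pi0 mui0]]]] :=
    @newton_slope_ex (size p) (fun i => p`_i != 0) v.
  exists (size p).-1; first by rewrite -ltnS prednK// sp /=.
  by rewrite -lead_coefE lead_coef_eq0 -size_poly_gt0.
(* The coefficient of [c^i sigma^i(u)] after substituting [c x^mu (sigma u / u)] and clearing [u],
   divided by [x^(v 0)]. By the choice of [mu] no negative exponent remains, and exponent [0] occurs
   both for [i = 0] and for some [i > 0]. *)
pose h i := puiseux_term (term_twist mu i) (mu * i%:R - v 0%N) * p`_i.
have hE i r : h i r = term_twist mu i * p`_i (r - (mu * i%:R - v 0%N)).
  by rewrite /h puiseux_termE.
have [|||c [u [u0 cuE]]] := @qdifference_puiseux_solution (size p) h a1.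
- move=> i r id r0; rewrite hE.
  have [->|pi0'] := eqVneq p`_i 0; first by rewrite mulr0.
  rewrite (vP i pi0').2 ?mulr0//; have := mumin i id pi0'.
  by lra.
- by rewrite hE mulf_neq0 ?term_twist_neq0// mulr0 sub0r sub0r opprK
    (vP 0%N p00).1.
- exists i0 => //; rewrite hE mulf_neq0 ?term_twist_neq0//.
  by rewrite sub0r opprB mui0 addrK (vP i0 pi0).1.
exists (puiseux_term c mu * (sigma u / u)).
transitivity (puiseux_term 1 (v 0%N) *
    (\sum_(i < size p) puiseux_term (c ^+ i) 0 * (h i * iter i sigma u)) / u);
  last by rewrite cuE mulr0 mul0r.
rewrite mulr_sumr mulr_suml; apply: eq_bigr => i _.
rewrite sigma_normM sigma_norm_coboundary// sigma_norm_term /h.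
have -> : puiseux_term (c ^+ i * term_twist mu i) (mu * i%:R) =
  puiseux_term 1 (v 0%N) * (puiseux_term (c ^+ i) 0 *
    puiseux_term (term_twist mu i) (mu * i%:R - v 0%N)).
  by rewrite !puiseux_termM mul1r add0r addrC subrK.
ring.
Qed.

Lemma qshift_closed : 1 < alpha%:num -> sigma_closed sigma.
Proof.
by move=> a1; apply: sigma_closed_of_zeros => p; exact: skew_eval_zero_ex.
Qed.

(** * The zeros of [(t - 1)^2], and nontriviality of [sigma] *)

Lemma qshift_coef0 (f : F) : qshift alpha f 0 = f 0.
Proof. by rewrite /= chi0 mul1r. Qed.

Lemma sigma_zero_sqr_eq1 (a : F) :
  sigma_zero ((skewT - 1) ^+ 2 : {skew sigma}) a <-> a = 1.
Proof.
rewrite sigma_zero_skewT_sub1_sqr; split=> [aE|->];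
  last by rewrite rmorph1; ring.
pose b := a - 1; have bE : sigma b * b + sigma b - b = 0.
  by rewrite -[RHS]aE /b rmorphB rmorph1; ring.
apply/eqP; rewrite -subr_eq0 -/b; apply: contraT => b0.
have sb0 : sigma b != 0 by rewrite fmorph_eq0.
have : sigma b^-1 - b^-1 = 1.
  (* Dividing this relation by [sigma b * b] turns it into the additive equation for [b^-1]. *)
  have bsb : b - sigma b = sigma b * b.
    by apply/esym/eqP; rewrite -subr_eq0 -[X in _ == X]bE; apply/eqP; ring.
  transitivity ((b - sigma b) / (sigma b * b)).
    by rewrite fmorphV invfM mulrBl mulrCA divff// mulr1 mulrA divff// mul1r.
  by rewrite bsb divff// mulf_neq0.
move=> /(congr1 (fun f : F => f 0)) /eqP.
have -> : (sigma b^-1 - b^-1 : F) 0 = sigma b^-1 0 - b^-1 0 by [].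
by rewrite qshift_coef0 subrr /= eq_sym oner_eq0.
Qed.

Lemma qshift_neq_id : 1 < alpha%:num -> ~ (sigma =1 id).
Proof.
move=> a1 /(_ (puiseux_monom 1)) /(congr1 (fun f : F => f 1)).
rewrite [LHS]qshift_monom /= mulr1 rmorph1 powRr1// => /(congr1 (@complex.Re R)) /= aE.
by rewrite aE ltxx in a1.
Qed.

End QShiftZeros.

Theorem mainTheorem4 (R : realType) :
  (forall alpha : {posnum R},
     let sigma : {rmorphism puiseux R[i] -> puiseux R[i]} := qshift alpha in
     let p : {skew sigma} := (skewT - 1) ^+ 2 in
     p = skewT ^+ 2 - skewC 2 * skewT + 1 /\
     (forall a : puiseux R[i], sigma_zero p a <-> a = 1)) /\
  (exists (K : fieldType) (sigma : {rmorphism K -> K}),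
     [/\ bijective sigma, ~ (sigma =1 id), sigma_closed sigma &
      exists p : {skew sigma},
        [/\ (2 < size (p : {poly K}))%N, (p : {poly K})`_0 != 0 &
         exists! a : K, sigma_zero p a]]).
Proof.
split=> [alpha sigma p|].
  by split=> [|a]; [exact: skewT_sub1_sqr|exact: sigma_zero_sqr_eq1].
(* The value [2] is a concrete [alpha > 1], as closedness and [sigma != id] are established in that
   range. *)
have two1 : 1 < (2%:pos : {posnum R})%:num by rewrite ltr1n.
exists (puiseux R[i]), (qshift (2%:pos : {posnum R})); split.
- exact: qshift_bij.
- exact: qshift_neq_id.
- exact: qshift_closed.
exists ((skewT - 1) ^+ 2); split.
- by rewrite skewT_sub1_sqr_poly size_skewT_sub1_sqr.
- by rewrite skewT_sub1_sqr_poly !coefE /= mulr0 subr0 add0r oner_neq0.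
exists 1; split=> [|a]; first exact/sigma_zero_sqr_eq1.
by move=> /sigma_zero_sqr_eq1.
Qed.
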